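(* Let $\mathcal{M}_1=(V,\mathcal{I}_1)$ and $\mathcal{M}_2=(V,\mathcal{I}_2)$ be two matroids on the same finite ground set $V$ (without loops). In the one-way communication model where Alice holds $V_A\subseteq V$ and Bob holds $V_B=V\setminus V_A$, there is a protocol that, for any given $\varepsilon>0$, has Alice send a single message consisting of $O(\mu(V)/\varepsilon)$ elements of $V_A$ to Bob, after which Bob outputs a set in $\mathcal{I}_1\cap\mathcal{I}_2$ of size at least $\mu(V)/(3/2+\varepsilon)$.
   Context: $\mu(V)$ denotes the maximum cardinality of a set in $\mathcal{I}_1\cap\mathcal{I}_2$. In the one-way communication model both parties know the matroids; Alice sends one message to Bob, and Bob must output the solution.
   Formalization: The message bound O(μ(V)/ε) is stated as C·μ(V)/min(ε,1) with an absolute constant C, since for large ε the literal bound C·μ(V)/ε would be below 1 and forbid any message (e.g. V = V_A a single element); for ε ≤ 1 it is exactly C·μ(V)/ε. *)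

(* Defs.v *)
From HB Require Import structures.
From mathcomp Require Import all_boot all_order all_algebra.
From mathcomp Require Import reals.

Set Implicit Arguments.
Unset Strict Implicit.
Unset Printing Implicit Defensive.

(* T is the publicly known universe on which both matroids live; the ground
   set of an instance is a subset V of T, carrying the restrictions of the two
   matroids to V.  If V were public, a party holding V_A would know V :\: V_A
   and communication would be pointless; taking V := [set: T] recovers the case
   where the matroids are given on V itself. *)
Record matroid (T : finType) := Matroid {
  indep : {set {set T}};
  indep0 : set0 \in indep;
  indepS : forall X Y : {set T}, X \subset Y -> Y \in indep -> X \in indep;
  indep_augment : forall X Y : {set T}, X \in indep -> Y \in indep ->
    #|X| < #|Y| -> exists2 y, y \in Y :\: X & y |: X \in indep
}.

Definition loopless (T : finType) (M : matroid T) (V : {set T}) : Prop :=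
  forall v, v \in V -> [set v] \in indep M.

Definition common_indep (T : finType) (M1 M2 : matroid T) : {set {set T}} :=
  indep M1 :&: indep M2.

Definition mu (T : finType) (M1 M2 : matroid T) (V : {set T}) : nat :=
  \max_(S in common_indep M1 M2 | S \subset V) #|S|.

(* Main.v *)
(** Write [r1], [r2] for the two rank functions.  For a set [S] and a level [k]
    let [u_k(S) = min_(X <= S) (#|S \ X| + k r(X))], the rank of [S] in the
    [k]-fold union of the matroid, and let [X_k], [Y_k] be its least and largest
    minimizers; they decrease with [k] and play the role of the set of elements
    of density more than, resp. at least, [k].  With [n = 2h], Alice sends a
    subset [S] of [V_A] maximizing
    [sum_(1 <= k <= n) (u1_k(S) + u2_k(S)) - (n + 1/2) #|S|].
    Local optimality says that an element of [S] lies in fewer than [n] of the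
    sets [X1_k], [X2_k], while an element of [V_A] outside [S] is spanned by at
    least [n] of the sets [Y1_k], [Y2_k]; this is the matroid counterpart of an
    edge-degree constrained subgraph.  In particular [#|S| <= n mu(V_A)].

    Let [m = mu(W)] for [W = S + V_B].  By matroid intersection [W = A + B] with
    [r1(A) + r2(B) <= m], and an optimal solution for [V] contains a set [I] of at
    least [mu(V) - m] elements that is independent over [A] in the first matroid
    and over [B] in the second one, so [I] lies in [V_A \ S].  Counting the pairs
    of an element of [S \ A] and a level in two ways gives
    [n sum_k #|{o in I spanned by Y1_k}| <= h(h+1) (#|I| + r2(B))], and
    symmetrically for [S \ B].  Adding both, [2(h-1) #|I| <= (h+1) m], that is
    [mu(V) <= (3/2 + 1/(h-1)) m]. *)
Require Import Defs.
From HB Require Import structures.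
From mathcomp Require Import all_boot all_order all_algebra.
From mathcomp Require Import reals.
From mathcomp Require Import zify lra.
Import Order.TTheory GRing.Theory Num.Theory.

Set Implicit Arguments.
Unset Strict Implicit.
Unset Printing Implicit Defensive.

Local Open Scope nat_scope.

Ltac set_cases z :=
  rewrite /is_true ?inE;
  repeat match goal with H : is_true (?A \subset ?B) |- _ =>
    move: H => /subsetP/(_ z); rewrite /is_true ?inE end;
  repeat match goal with |- context [z \in ?A] => case: (z \in A) end;
  repeat match goal with |- context [z == ?y] => case: (z == y) end;
  rewrite /=; intuition discriminate.
Ltac set_eq := let z := fresh "z" in apply/setP => z; set_cases z.
Ltac set_sub := let z := fresh "z" in apply/subsetP => z; set_cases z.

(** * Matroids through their rank functions *)

Record rank_function (T : finType) := RankFunction {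
  rk :> {set T} -> nat;
  rk_set0 : rk set0 = 0;
  rkS : forall X Y : {set T}, X \subset Y -> rk X <= rk Y;
  rkU1 : forall x (X : {set T}), rk (x |: X) <= (rk X).+1;
  rk_submod : forall X Y : {set T}, rk (X :|: Y) + rk (X :&: Y) <= rk X + rk Y
}.

Section RankFunction.
Variables (T : finType) (r : rank_function T).
Implicit Types (X Y Z U A B S I : {set T}) (x : T).

Lemma rk_submod_le X Y U Z :
  U \subset X :|: Y -> Z \subset X :&: Y -> r U + r Z <= r X + r Y.
Proof. by move=> /(rkS r) sU /(rkS r) sZ; have := rk_submod r X Y; lia. Qed.

Lemma rkU X Y : r (X :|: Y) <= r X + #|Y|.
Proof.
have [n] := ubnP #|Y|; elim: n Y => // n IHn Y ltYn.
have [->|[y Yy]] := set_0Vmem Y; first by rewrite setU0 cards0 addn0.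
have cY := cardsD1 y Y; rewrite Yy in cY.
have ltn : #|Y :\ y| < n by lia.
have := IHn (Y :\ y) ltn; rewrite -[in r (X :|: Y)](setD1K Yy) setUCA.
by have := rkU1 r y (X :|: Y :\ y); lia.
Qed.

Lemma rk_le_card X : r X <= #|X|.
Proof. by have := rkU set0 X; rewrite set0U rk_set0. Qed.

(** The hypothesis on [Y] is independence in the contraction by [A]. Adding [X] and then [Y :\: X]
    raises the rank by at most their cardinalities, so equality in total forces equality for [X]. *)
Lemma rk_contract_indepS A X Y :
  X \subset Y -> r (A :|: Y) = r A + #|Y| -> r (A :|: X) = r A + #|X|.
Proof.
move=> sXY rY; have := rkU A X; have := rkU (A :|: X) (Y :\: X).
have := cardsID X Y; rewrite (setIidPr sXY).
have -> : A :|: X :|: Y :\: X = A :|: Y by set_eq.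
lia.
Qed.

Lemma rk_indepS X Y : X \subset Y -> r Y = #|Y| -> r X = #|X|.
Proof.
move=> sXY rY; have := @rk_contract_indepS set0 X Y sXY.
by rewrite !set0U rk_set0 => ->.
Qed.

(** Greedy choice: [y] joins a basis [J] of [I :\ y] exactly when it raises the rank of [A :|: J];
    otherwise submodularity shows that it does not raise the rank of [A :|: I :\ y] either. *)
Lemma rk_contract_basis A I :
  exists2 J : {set T}, J \subset I &
    r (A :|: J) = r A + #|J| /\ r (A :|: J) = r (A :|: I).
Proof.
have [n] := ubnP #|I|; elim: n I => // n IHn I ltIn.
have [->|[y Iy]] := set_0Vmem I.
  by exists set0; rewrite ?sub0set // setU0 cards0 addn0.
have cI := cardsD1 y I; rewrite Iy in cI.
have ltn : #|I :\ y| < n by lia.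
have [J sJ [rJ rJI]] := IHn _ ltn.
have sJI : J \subset I by apply: subset_trans sJ (subsetDl _ _).
have yJ : y \notin J by apply/negP => /(subsetP sJ); rewrite !inE eqxx.
have eqI : y |: (A :|: I :\ y) = A :|: I by rewrite setUCA setD1K.
have le1 : r (A :|: I) + r (A :|: J) <= r (y |: (A :|: J)) + r (A :|: I :\ y).
  by apply: rk_submod_le; [rewrite -eqI; set_sub | set_sub].
have sIy : r (A :|: I :\ y) <= r (A :|: I) by apply: rkS; set_sub.
have le2 := rkU1 r y (A :|: J).
have le3 : r (y |: (A :|: J)) <= r (A :|: I) by rewrite -eqI; apply: rkS; set_sub.
have [eq1|ne1] := eqVneq (r (y |: (A :|: J))) (r (A :|: J)).
  by exists J => //; split=> //; lia.
exists (y |: J); first by rewrite subUset sub1set Iy.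
have le4 : r (A :|: J) <= r (y |: (A :|: J)) by apply: rkS; set_sub.
by rewrite setUCA cardsU1 yJ; split; lia.
Qed.

End RankFunction.

(** * Contraction of an element and matroid intersection *)

Section Contract.
Variables (T : finType) (r : rank_function T) (e : T) (re : r [set e] = 1).

(** The 1 is [r [set e]]; by monotonicity the subtraction is never truncated. *)
Definition contract_rk (X : {set T}) := r (e |: X) - 1.

Let rk_gt0 X : 0 < r (e |: X).
Proof. by rewrite -re rkS // subsetUl. Qed.

Fact contract_rk_set0 : contract_rk set0 = 0.
Proof. by rewrite /contract_rk setU0 re. Qed.

Fact contract_rkS (X Y : {set T}) : X \subset Y -> contract_rk X <= contract_rk Y.
Proof. by move=> sXY; apply: leq_sub2r; rewrite rkS // setUS. Qed.

Fact contract_rkU1 x (X : {set T}) : contract_rk (x |: X) <= (contract_rk X).+1.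
Proof.
by rewrite /contract_rk setUCA; have := rkU1 r x (e |: X); have := rk_gt0 X; lia.
Qed.

Fact contract_rk_submod (X Y : {set T}) :
  contract_rk (X :|: Y) + contract_rk (X :&: Y) <= contract_rk X + contract_rk Y.
Proof.
rewrite /contract_rk.
have : r (e |: (X :|: Y)) + r (e |: (X :&: Y)) <= r (e |: X) + r (e |: Y).
  by apply: rk_submod_le; set_sub.
have := (rk_gt0 X, rk_gt0 Y, rk_gt0 (X :|: Y), rk_gt0 (X :&: Y)).
by case=> [[[]]]; lia.
Qed.

Definition contract : rank_function T :=
  RankFunction contract_rk_set0 contract_rkS contract_rkU1 contract_rk_submod.

End Contract.

(** The hard direction of Edmonds' min-max formula. If a set [A] violates the bound after deleting
    [e] and a set [B] after contracting it, they uncross: by submodularity the bounds at [A :|: B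
    :|: [set e]] and [A :&: B] cannot both hold. *)
Theorem matroid_intersection (T : finType) (r1 r2 : rank_function T) (E : {set T}) k :
  (forall A : {set T}, A \subset E -> k <= r1 A + r2 (E :\: A)) ->
  exists2 I : {set T}, I \subset E & [/\ #|I| = k, r1 I = k & r2 I = k].
Proof.
have [n] := ubnP #|E|; elim: n E r1 r2 k => // n IHn E r1 r2 k ltEn lek.
case: k lek => [|k] lek.
  by exists set0; rewrite ?sub0set // !rk_set0 cards0.
(* An element that is a loop of neither matroid is either deleted or contracted. *)
have [/existsP[e /and3P[Ee /eqP r1e /eqP r2e]]|/existsPn loopE] :=
  boolP [exists e, [&& e \in E, r1 [set e] == 1 & r2 [set e] == 1]]; last first.
  (* Every element of [E :\: A] is a loop of the second matroid, so the bound at [A] reads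
     [k.+1 <= 0]. *)
  pose A := [set x in E | r1 [set x] == 0].
  have rk0 (r : rank_function T) (X : {set T}) :
    {in X, forall x, r [set x] = 0} -> r X = 0.
    have [m] := ubnP #|X|; elim: m X => // m IHm X ltXm r0.
    have [->|[x Xx]] := set_0Vmem X; first exact: rk_set0.
    have cX := cardsD1 x X; rewrite Xx in cX.
    have ltm : #|X :\ x| < m by lia.
    have r0' : r (X :\ x) = 0 by apply: IHm => // y /setD1P[_ /r0].
    by have := rk_submod r [set x] (X :\ x); rewrite setD1K // r0 // r0'; lia.
  have := lek A; rewrite rk0 => [|x]; last by rewrite inE => /andP[_ /eqP].
  rewrite rk0 => [|x]; last first.
    rewrite !inE; have := loopE x; rewrite andbC; case: (x \in E) => //=.
    by have := rk_le_card r1 [set x]; have := rk_le_card r2 [set x]; rewrite cards1; lia.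
  by rewrite ltn0 => H; exfalso; apply/notF/H/subsetP => x; rewrite inE => /andP[].
have cE := cardsD1 e E; rewrite Ee in cE.
have ltn : #|E :\ e| < n by lia.
have [delP|/forallPn[A]] := boolP [forall A : {set T}, (A \subset E :\ e) ==>
    (k.+1 <= r1 A + r2 ((E :\ e) :\: A))].
  have [A sA|I sI eI] := IHn (E :\ e) r1 r2 k.+1 ltn.
    by have /forallP/(_ A)/implyP/(_ sA) := delP.
  by exists I => //; apply: subset_trans sI (subsetDl _ _).
rewrite negb_imply -ltnNge => /andP[sA ltA].
have [conP|/forallPn[B]] := boolP [forall B : {set T}, (B \subset E :\ e) ==>
    (k <= contract r1e B + contract r2e ((E :\ e) :\: B))].
  have [B sB|I sI [cI]] := IHn (E :\ e) (contract r1e) (contract r2e) k ltn.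
    by have /forallP/(_ B)/implyP/(_ sB) := conP.
  rewrite /= /contract_rk => r1I r2I.
  exists (e |: I); first by rewrite subUset sub1set Ee (subset_trans sI) ?subsetDl.
  have eI : e \notin I by apply/negP => /(subsetP sI); rewrite !inE eqxx.
  have le1 : r1 [set e] <= r1 (e |: I) by apply: rkS; set_sub.
  have le2 : r2 [set e] <= r2 (e |: I) by apply: rkS; set_sub.
  by rewrite cardsU1 eI; split; lia.
rewrite negb_imply -ltnNge /= /contract_rk => /andP[sB ltB].
have sub1 : A :|: B :|: [set e] \subset E.
  by rewrite !subUset sub1set Ee !(subset_trans _ (subsetDl E [set e])).
have sub2 : A :&: B \subset E by apply: subset_trans sub1; set_sub.
have := lek _ sub1; have := lek _ sub2.
have : r1 (A :|: B :|: [set e]) + r1 (A :&: B) <= r1 A + r1 (e |: B).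
  by apply: rk_submod_le; set_sub.
have : r2 (E :\: (A :&: B)) + r2 (E :\: (A :|: B :|: [set e])) <=
       r2 ((E :\ e) :\: A) + r2 (e |: (E :\ e) :\: B).
  by apply: rk_submod_le; set_sub.
lia.
Qed.

(** * Minimizers of the deficit at the successive density levels *)

Section DensityLevels.
Variables (T : finType) (r : rank_function T) (S : {set T}).
Implicit Types (X Y Z A B I : {set T}) (x : T).

Definition deficit k X := #|S :\: X| + k * r X.

Definition tight k X :=
  X \subset S /\ forall Z, Z \subset S -> deficit k X <= deficit k Z.

(* The factor [#|T|.+1] makes the minimization lexicographic: a minimizer of the
   deficit that has least, resp. largest, cardinality. *)
Definition tight_min k :=
  [arg min_(X < S | X \subset S) (deficit k X * #|T|.+1 + #|X|)].

Definition tight_max k :=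
  [arg min_(X < S | X \subset S) (deficit k X * #|T|.+1 + #|S :\: X|)].

Definition union_rank k := deficit k (tight_min k).

Let lex_le m n a b : a <= #|T| -> b <= #|T| ->
  m * #|T|.+1 + a <= n * #|T|.+1 + b -> m <= n /\ (m = n -> a <= b).
Proof. by move=> la lb le_mn; split; [nia | move=> eq_mn; lia]. Qed.

Lemma tight_minP k : tight k (tight_min k) /\
  forall Z, tight k Z -> #|tight_min k| <= #|Z|.
Proof.
rewrite /tight_min; case: arg_minnP => //= X sX minX.
have minX2 Z := fun sZ => lex_le (max_card _) (max_card _) (minX Z sZ).
split; first by split=> // Z /minX2[].
by move=> Z [/minX2[le1 le2] minZ]; apply: le2; have := minZ X sX; lia.
Qed.

Lemma tight_maxP k : tight k (tight_max k) /\
  forall Z, tight k Z -> #|S :\: tight_max k| <= #|S :\: Z|.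
Proof.
rewrite /tight_max; case: arg_minnP => //= X sX minX.
have minX2 Z := fun sZ => lex_le (max_card _) (max_card _) (minX Z sZ).
split; first by split=> // Z /minX2[].
by move=> Z [/minX2[le1 le2] minZ]; apply: le2; have := minZ X sX; lia.
Qed.

(** Uncrossing across two levels: [d = 0] makes the tight sets of one level a lattice, and [d > 0]
    orders the tight sets of different levels. *)
Lemma deficit_submod k d X Y : X \subset S -> Y \subset S ->
  deficit k (X :|: Y) + deficit (k + d) (X :&: Y) + d * r Y <=
  deficit k X + deficit (k + d) Y + d * r (X :&: Y).
Proof.
move=> sX sY; rewrite /deficit.
have cE : #|S :\: (X :|: Y)| + #|S :\: (X :&: Y)| = #|S :\: X| + #|S :\: Y|.
  by rewrite setDUr setDIr addnC cardsUI.
have := leq_mul (leqnn k) (rk_submod r X Y).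
by rewrite !mulnDr !mulnDl; lia.
Qed.

Lemma tightUI k X Y : tight k X -> tight k Y ->
  tight k (X :|: Y) /\ tight k (X :&: Y).
Proof.
move=> [sX minX] [sY minY]; have := deficit_submod k 0 sX sY.
have sU : X :|: Y \subset S by rewrite subUset sX.
have sI : X :&: Y \subset S by apply: subset_trans sX; apply: subsetIl.
have := minX _ sU; have := minX _ sI; rewrite addn0.
move=> le1 le2 le3; split; split=> // Z sZ.
  by have := minY _ sI; have := minX Z sZ; lia.
by have := minY _ sU; have := minX Z sZ; have := minY Z sZ; lia.
Qed.

Lemma tight_min_sub k Z : tight k Z -> tight_min k \subset Z.
Proof.
move=> tZ; have [tX minX] := tight_minP k.
have /minX := (tightUI tX tZ).2; rewrite -(cardsID Z (tight_min k)) => le1.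
by rewrite -setD_eq0 -cards_eq0; lia.
Qed.

Lemma sub_tight_max k Z : tight k Z -> Z \subset tight_max k.
Proof.
move=> tZ; have [tX maxX] := tight_maxP k.
have /maxX := (tightUI tX tZ).1; have := cardsID Z (S :\: tight_max k).
have -> : (S :\: tight_max k) :\: Z = S :\: (tight_max k :|: Z) by set_eq.
have -> : (S :\: tight_max k) :&: Z = Z :\: tight_max k.
  by have [sZ _] := tZ; set_eq.
by move=> c1 c2; rewrite -setD_eq0 -cards_eq0; lia.
Qed.

(** Uncrossing leaves no slack, so [Y] and [X :&: Y] have the same rank; minimality of [Y] then
    compares cardinalities only. As the tight sets are arbitrary, even the largest one of level
    [k.+1] lies in the least one of level [k]. *)
Lemma tight_anti k k' X Y : k < k' -> tight k X -> tight k' Y -> Y \subset X.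
Proof.
move=> ltk [sX minX] [sY minY]; have := deficit_submod k (k' - k) sX sY.
rewrite subnKC ?(ltnW ltk) //.
have sU : X :|: Y \subset S by rewrite subUset sX.
have sI : X :&: Y \subset S by apply: subset_trans sX; apply: subsetIl.
have := minX _ sU; have := minY _ sI => le1 le2 le3.
have /(rkS r) sIY : X :&: Y \subset Y by apply: subsetIr.
have eqr : r Y = r (X :&: Y).
  apply/eqP; rewrite eqn_leq sIY andbT -(@leq_pmul2l (k' - k)) ?subn_gt0 //; lia.
have : deficit k' (X :&: Y) <= deficit k' Y by rewrite eqr in le3; lia.
rewrite /deficit eqr leq_add2r.
have -> : S :\: (X :&: Y) = (S :\: Y) :|: (Y :\: X) by set_eq.
rewrite cardsU (_ : _ :&: _ = set0); last by set_eq.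
by rewrite cards0 -setD_eq0 -cards_eq0; lia.
Qed.

Lemma tight_min_anti k k' : k <= k' -> tight_min k' \subset tight_min k.
Proof.
rewrite leq_eqVlt => /predU1P[-> //|ltk].
exact: tight_anti ltk (tight_minP _).1 (tight_minP _).1.
Qed.

Lemma tight_max_nest k : tight_max k.+1 \subset tight_max k.
Proof. exact: tight_anti (ltnSn k) (tight_maxP _).1 (tight_maxP _).1. Qed.

Lemma tight_max_min k : tight_max k.+1 \subset tight_min k.
Proof. exact: tight_anti (ltnSn k) (tight_minP _).1 (tight_maxP _).1. Qed.

Lemma union_rank_le k X : X \subset S -> union_rank k <= deficit k X.
Proof. by move=> sX; have [[_ minX] _] := tight_minP k; apply: minX. Qed.

End DensityLevels.

(** * Change of the union rank when one element is removed or added *)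

Section Marginals.
Variables (T : finType) (r : rank_function T) (S : {set T}).

(** A minimizer for [S :\ v] has deficit exactly one more in [S]. If the union rank drops, this set
    is tight for [S] and avoids [v], hence so does the least tight set. *)
Lemma union_rankD1 k v : v \in S ->
  union_rank r S k <= union_rank r (S :\ v) k + (v \notin tight_min r S k).
Proof.
move=> Sv; have [[sZ minZ] _] := tight_minP r (S :\ v) k.
set Z := tight_min r (S :\ v) k in sZ minZ *.
have vZ : v \notin Z by apply/negP => /(subsetP sZ); rewrite !inE eqxx.
have sZS : Z \subset S by apply: subset_trans sZ (subsetDl _ _).
have eZ : deficit r S k Z = (union_rank r (S :\ v) k).+1.
  rewrite /union_rank -/Z /deficit (cardsD1 v) !inE Sv vZ /= add1n addSn.
  by congr (_.+1 + _); apply: eq_card => x; rewrite !inE andbCA.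
have le1 := union_rank_le r k sZS.
case: (boolP (v \in _)) => [vX|_]; last by rewrite addn1 -eZ.
rewrite addn0 -ltnS -eZ ltn_neqAle le1 andbT; apply: contra vZ => /eqP eqZ.
apply: subsetP vX; apply: tight_min_sub; split=> // Z' sZ'.
by rewrite -eqZ union_rank_le.
Qed.

(** Let [Z] be a minimizer for [o |: S]. If [Z] misses [o], then [o] costs one in cardinality. If
    [Z] contains [o] and the union rank does not grow, then [Z :\ o] is tight for [S] and has the
    rank of [Z]; so it spans [o], and so does the largest tight set. *)
Lemma union_rankU1 k o : o \notin S -> 0 < k ->
  union_rank r S k + (r (o |: tight_max r S k) != r (tight_max r S k)) <=
  union_rank r (o |: S) k.
Proof.
move=> So k_gt0; have [[sZ minZ] _] := tight_minP r (o |: S) k.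
rewrite [union_rank r (o |: S) k]/union_rank.
set Z := tight_min r (o |: S) k in sZ minZ *.
have sZS : Z :\ o \subset S by rewrite subDset.
have le1 := union_rank_le r k sZS.
have [oZ|oZ] := boolP (o \in Z); last first.
  have eZ : Z :\ o = Z by apply/setDidPl; rewrite disjoint_sym disjoints1.
  rewrite eZ in le1; suff -> : deficit r (o |: S) k Z = (deficit r S k Z).+1.
    by rewrite -addn1; apply: leq_add le1 _; case: (_ != _).
  rewrite /deficit (cardsD1 o) !inE eqxx oZ /= add1n addSn.
  congr (_.+1 + _); apply: eq_card => x; rewrite !inE.
  by case: eqP => [->|] //=; rewrite (negPf So) andbF.
have eZ : deficit r (o |: S) k Z = #|S :\: (Z :\ o)| + k * r Z.
  congr (_ + _); apply: eq_card => x; rewrite !inE.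
  by case: eqP => [->|] //=; rewrite oZ (negPf So).
have /(rkS r) leZ : Z :\ o \subset Z by apply: subsetDl.
have le2 : k * r (Z :\ o) <= k * r Z by rewrite leq_mul.
rewrite /deficit in le1; rewrite eZ.
have [_|neq] := eqVneq; first by rewrite addn0; lia.
rewrite addn1 ltnNge; apply: contra neq => le3.
have tZ : tight r S k (Z :\ o).
  by split=> // Z' /(union_rank_le r k); rewrite [in X in X -> _]/deficit /deficit; lia.
have eqk : k * r (Z :\ o) = k * r Z by lia.
have {eqk} eqr : r (Z :\ o) = r Z by apply/eqP; rewrite -(eqn_pmul2l k_gt0) eqk.
have sM := sub_tight_max tZ.
rewrite eqn_leq (rkS r (subsetUr _ _)) andbT.
have := @rk_submod_le _ r Z (tight_max r S k) (o |: tight_max r S k) (Z :\ o).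
rewrite subUset sub1set inE oZ subsetUr /= subsetI subsetDl sM => /(_ isT isT).
lia.
Qed.

End Marginals.

(** * Truncated sums and summation by parts *)

Lemma sum_truncated h c :
  \sum_(j < h.*2.+1) c * (j.*2 - h.*2) = c * (h * h.+1).
Proof.
rewrite -big_distrr /=; congr (c * _).
elim: h => [|h IHh]; first by rewrite big_ord_recl big_ord0.
rewrite doubleS big_ord_recl big_ord_recr /=.
have := IHh; under [X in _ = _ -> _ + (X + _) = _]eq_bigr => j _ do
  rewrite /bump /= add1n !doubleS !subSS.
by move=> ->; rewrite /bump /=; lia.
Qed.

Lemma sum_truncated_rev h m : \sum_(k < m) (h.*2 - k.*2) <= h * h.+1.
Proof.
(* The added product is the tail of the sum from [m] on, zero once [h <= m]. *)
suff <- : \sum_(k < m) (h.*2 - k.*2) + (h - m) * (h - m).+1 = h * h.+1.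
  exact: leq_addr.
elim: m => [|m IHm]; first by rewrite big_ord0 subn0.
rewrite -IHm big_ord_recr /= -addnA; congr (_ + _).
have [ltm|lem] := ltnP m h; last first.
  have [-> -> ->] // : [/\ h - m = 0, h - m.+1 = 0 & h.*2 - m.*2 = 0].
  by split; lia.
have -> : h - m = (h - m.+1).+1 by lia.
have -> : h.*2 - m.*2 = (h - m.+1).+1.*2 by lia.
by move: (h - m.+1) => t; nia.
Qed.

(** Summing the increments bounds [g n] by [n * R n] minus the earlier [R j]; summing again bounds
    the left side by the sum of [(2j - 2h) * R j] over [j <= 2h]. Negative coefficients are dropped,
    and the positive ones add up to [h * h.+1]. *)
Lemma abel_upper (g R : nat -> nat) M h :
  g 0 = 0 -> (forall k, R k <= M) ->
  (forall k, g k.+1 + k.+1 * R k <= g k + k.+1 * R k.+1) ->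
  \sum_(k < h.*2) g k.+1 <= h * h.+1 * M.
Proof.
move=> g0 leR step.
have gR n : g n + \sum_(j < n) R j <= n * R n.
  elim: n => [|n IHn]; first by rewrite g0 big_ord0.
  rewrite big_ord_recr /=; have := step n; move: IHn; rewrite !mulSn.
  by move: (\sum_(j < n) R j) => s; lia.
have sumg n : \sum_(k < n) g k.+1 + \sum_(j < n.+1) (n - j) * R j <=
              \sum_(j < n.+1) j * R j.
  elim: n => [|n IHn]; first by rewrite big_ord0 !big_ord_recl !big_ord0 subnn.
  rewrite big_ord_recr [in X in _ + X]big_ord_recr [in X in _ <= X]big_ord_recr /=.
  rewrite subnn mul0n addn0.
  have -> : \sum_(j < n.+1) (n.+1 - j) * R j =
            \sum_(j < n.+1) (n - j) * R j + \sum_(j < n.+1) R j.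
    by rewrite -big_split; apply: eq_bigr => j _; have := ltn_ord j; rewrite /=; nia.
  move: IHn (gR n.+1); move: (\sum_(j < n.+1) R j) (\sum_(j < n.+1) (n - j) * R j).
  by move: (\sum_(k < n) g k.+1) (\sum_(i < n.+1) i * R i) => s t u v; lia.
have : \sum_(j < h.*2.+1) j * R j <= \sum_(j < h.*2.+1) (h.*2 - j) * R j +
         \sum_(j < h.*2.+1) M * (j.*2 - h.*2).
  rewrite -big_split; apply: leq_sum => j _; have := leR j; have := ltn_ord j.
  case: (leqP j h) => [lejh|ltjh] ltj leRM /=.
    by apply: leq_trans (leq_addr _ _); apply: leq_mul => //; lia.
  have -> : j * R j = (h.*2 - j) * R j + (j.*2 - h.*2) * R j.
    by rewrite -mulnDl; congr (_ * _); lia.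
  by rewrite leq_add2l mulnC leq_mul.
by rewrite sum_truncated [M * _]mulnC; have := sumg h.*2; lia.
Qed.

(** Descending from the top level, [c k] is at least [k * E k] plus all later [E]. In the sum over
    levels, [E (k + j)] receives [k + j] from its own level and 1 from each of the [j] levels before
    it. *)
Lemma abel_lower (c E : nat -> nat) n :
  n * E n <= c n ->
  (forall k, k < n -> c k.+1 + k * E k <= c k + k * E k.+1) ->
  forall d k, k + d = n ->
  \sum_(j < d.+1) (k + j.*2) * E (k + j) <= \sum_(j < d.+1) c (k + j).
Proof.
move=> top step.
have sum_recl (F : nat -> nat) m :
  \sum_(j < m.+1) F j = F 0 + \sum_(j < m) F j.+1 by exact: big_ord_recl.
have shift (F : nat -> nat) m k :
    \sum_(j < m) F (k + j.+1) = \sum_(j < m) F (k.+1 + j).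
  by apply: eq_bigr => j _; rewrite addnS.
have cE d : forall k, k + d = n -> k * E k + \sum_(j < d) E (k.+1 + j) <= c k.
  elim: d => [|d IHd] k eqn.
    by move: eqn; rewrite big_ord0 !addn0 => ->.
  have ltkn : k < n by lia.
  have := IHd k.+1; rewrite addSnnS => /(_ eqn).
  have := step k ltkn; rewrite mulSn (sum_recl (fun j => E (k.+1 + j))) addn0.
  by rewrite (shift E d k.+1); move: (\sum_(i < d) E (k.+2 + i)) => s; lia.
elim=> [|d IHd] k eqn; have := cE _ _ eqn.
  by rewrite !big_ord_recl !big_ord0 !addn0.
have := IHd k.+1; rewrite addSnnS => /(_ eqn).
rewrite (sum_recl (fun j => (k + j.*2) * E (k + j))) (sum_recl (fun j => c (k + j))).
rewrite !addn0 (shift c d.+1 k).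
have -> : \sum_(i < d.+1) (k + i.+1.*2) * E (k + i.+1) =
  \sum_(i < d.+1) E (k.+1 + i) + \sum_(i < d.+1) (k.+1 + i.*2) * E (k.+1 + i).
  rewrite -big_split; apply: eq_bigr => i _ /=.
  by rewrite -mulSn (_ : k + i.+1 = k.+1 + i); [congr (_ * _); lia | lia].
move: (\sum_(i < d.+1) E _) (\sum_(i < d.+1) c _) => s t.
by move: (\sum_(i < d.+1) _ * _) => u; lia.
Qed.

(** * Spans, and counting elements against levels *)

Lemma rk_span (T : finType) (r : rank_function T) (Y D : {set T}) :
  {in D, forall o, r (o |: Y) = r Y} -> r (Y :|: D) = r Y.
Proof.
have [n] := ubnP #|D|; elim: n D => // n IHn D ltDn spanD.
have [->|[y Dy]] := set_0Vmem D; first by rewrite setU0.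
have cD := cardsD1 y D; rewrite Dy in cD.
have ltn : #|D :\ y| < n by lia.
have eqD : r (Y :|: D :\ y) = r Y by apply: IHn => // x /setD1P[_ /spanD].
apply/eqP; rewrite eqn_leq [X in _ && X](rkS r (subsetUl _ _)) andbT.
have : r (Y :|: D) + r Y <= r (y |: Y) + r (Y :|: D :\ y).
  by apply: rk_submod_le; [rewrite -{1}(setD1K Dy); set_sub | set_sub].
by rewrite spanD // eqD; lia.
Qed.

Lemma sum_card_setI (T : finType) n (P : {set T}) (X : 'I_n -> {set T}) :
  \sum_(k < n) #|P :&: X k| = \sum_(v in P) \sum_(k < n) (v \in X k).
Proof.
rewrite exchange_big; apply: eq_bigr => k _; rewrite -sum1_card.
rewrite big_mkcond [in RHS]big_mkcond; apply: eq_bigr => v _.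
by rewrite inE; case: (v \in P) => //=; case: (v \in X k).
Qed.

Definition spanned (T : finType) (r : rank_function T) (Y : {set T}) :=
  [set o | r (o |: Y) == r Y].

(** The part of [I] spanned by [Y] is still independent over [A], and adding it to [Y :|: A] does
    not raise the rank. *)
Lemma card_spanned (T : finType) (r : rank_function T) (A Y I : {set T}) :
  r (A :|: I) = r A + #|I| -> #|I :&: spanned r Y| + r A <= r (Y :|: A).
Proof.
move=> rI; have sI : I :&: spanned r Y \subset I by apply: subsetIl.
have := rk_contract_indepS sI rI; rewrite [_ + #|_|]addnC => <-.
set D := I :&: _; rewrite -(@rk_span _ r (Y :|: A) D).
  by apply: rkS; set_sub.
move=> o /setIP[_]; rewrite inE => /eqP eqo.
apply/eqP; rewrite eqn_leq [X in _ && X](rkS r (subsetUr _ _)) andbT.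
have : r (o |: (Y :|: A)) + r Y <= r (o |: Y) + r (Y :|: A).
  by apply: rk_submod_le; set_sub.
lia.
Qed.

Section Counting.
Variables (T : finType) (r : rank_function T) (S : {set T}).
Implicit Types (A B I : {set T}).

(** An instance of [abel_upper] in which [R k] is the rank of [B0] over [X k]. The increment
    condition compares the minimizer [X k.+1] with its enlargement by [B0 :&: X k]. *)
Lemma sum_outside_tight_min B h :
  \sum_(k < h.*2) #|(S :&: B) :\: tight_min r S k.+1| <= h * h.+1 * r B.
Proof.
pose X := tight_min r S; pose B0 := S :&: B.
have rkX k : r (X k) <= r (X k :|: B0) by apply: rkS; set_sub.
apply: (@abel_upper (fun k => #|B0 :\: X k|) (fun k => r (X k :|: B0) - r (X k))).
(* At level 0 the rank has weight 0, so the only minimizer is [S] itself. *)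
- have [[sX minX] _] := tight_minP r S 0.
  have := minX _ (subxx S); rewrite /deficit !mul0n setDv cards0 !addn0 leqn0.
  rewrite cards_eq0 setD_eq0 -/(X 0) => sS; apply/eqP.
  by rewrite cards_eq0 setD_eq0; apply: subset_trans sS; apply: subsetIl.
- move=> k; have := rkU r (X k) B0.
  have : r (X k :|: B0) + 0 <= r (X k) + r B.
    rewrite -(rk_set0 r); apply: rk_submod_le; set_sub.
  lia.
move=> k; pose Z := X k.+1 :|: B0 :&: X k.
have [[sX minX] _] := tight_minP r S k.+1; rewrite -/(X k.+1) in sX minX.
have sZ : Z \subset S by rewrite /Z /B0; set_sub.
have sXX : X k.+1 \subset X k by apply: tight_min_anti.
have := minX Z sZ; rewrite /deficit.
have -> : #|S :\: X k.+1| = #|S :\: Z| + #|(B0 :&: X k) :\: X k.+1|.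
  rewrite -(cardsID (B0 :&: X k) (S :\: X k.+1)) addnC.
  by congr (_ + _); apply: eq_card => z; rewrite /Z /B0; set_cases z.
have -> : #|B0 :\: X k.+1| = #|B0 :\: X k| + #|(B0 :&: X k) :\: X k.+1|.
  rewrite -(cardsID (X k) (B0 :\: X k.+1)) addnC.
  by congr (_ + _); apply: eq_card => z; set_cases z.
have le1 : r Z + r (X k :|: B0) <= r (X k.+1 :|: B0) + r (X k).
  have : r (X k :|: B0) + r Z <= r (X k.+1 :|: B0) + r (X k).
    by apply: rk_submod_le; rewrite /Z; set_sub.
  lia.
have le2 : r Z + (r (X k :|: B0) - r (X k)) <=
    r (X k.+1) + (r (X k.+1 :|: B0) - r (X k.+1)).
  by have := rkX k; have := rkX k.+1; lia.
have := leq_mul (leqnn k.+1) le2; rewrite !mulnDr; lia.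
Qed.

(** The rank [E k] of [Y k] over [A] bounds the part of [I] spanned by [Y k]. As [Y k] has density
    at least [k], [abel_lower] bounds a weighted sum of [E] by the sizes of [Y k :\: A], and
    [Y k.+1] lies in the least minimizer of level [k]. *)
Lemma sum_spanned_le A I h : 0 < h -> r (A :|: I) = r A + #|I| ->
  \sum_(k < h.*2) h.*2 * #|I :&: spanned r (tight_max r S k.+1)| <=
  h * h.+1 * #|I| + \sum_(k < h.*2) #|(S :\: A) :&: tight_min r S k.+1|.
Proof.
case: h => // q _; set h := q.+1.
move=> rI; pose Y := tight_max r S; pose n := q.*2.+2.
pose E k := r (Y k :|: A) - r A; pose c k := #|Y k :\: A|.
have rkA k : r A <= r (Y k :|: A) by apply: rkS; set_sub.
have tightY k (Z : {set T}) : Z \subset Y k -> k * r (Y k) <= #|Y k :\: Z| + k * r Z.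
  move=> sZ; have [[sY minY] _] := tight_maxP r S k; rewrite -/(Y k) in sY minY.
  have := minY Z (subset_trans sZ sY); rewrite /deficit.
  have -> : #|S :\: Z| = #|S :\: Y k| + #|Y k :\: Z|; last by lia.
  rewrite -(cardsID (Y k) (S :\: Z)) addnC.
  by congr (_ + _); apply: eq_card => z; set_cases z.
have top k : k * E k <= c k.
  have := tightY k _ (subsetIl (Y k) A); rewrite setDIr setDv set0U -/(c k).
  have := rk_submod r (Y k) A; have := rkA k => le1 le2.
  have le3 : E k + r (Y k :&: A) <= r (Y k) by rewrite /E; lia.
  by have := leq_mul (leqnn k) le3; rewrite mulnDr; lia.
have step k : c k.+1 + k * E k <= c k + k * E k.+1.
  have sY : Y k.+1 \subset Y k by apply: tight_max_nest.
  pose Z := Y k.+1 :|: Y k :&: A.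
  have sZ : Z \subset Y k by rewrite /Z; set_sub.
  have := tightY k Z sZ.
  have -> : c k = #|Y k :\: Z| + c k.+1.
    rewrite /c -(cardsID (Y k.+1) (Y k :\: A)) addnC.
    by congr (_ + _); apply: eq_card => z; rewrite /Z; set_cases z.
  have : r (Y k :|: A) + r Z <= r (Y k.+1 :|: A) + r (Y k).
    by apply: rk_submod_le; rewrite /Z; set_sub.
  have := rkA k; have := rkA k.+1 => le1 le2 le3.
  have le4 : E k + r Z <= E k.+1 + r (Y k) by rewrite /E; lia.
  by have := leq_mul (leqnn k) le4; rewrite !mulnDr; lia.
(* Starting at level 2 produces the weights [2k] of [E k.+1] needed in [leD], where level 1 has
   weight 0. *)
have := abel_lower (top n) (fun k _ => step k) (erefl (2 + q.*2)).
pose D k := #|I :&: spanned r (Y k)|.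
have DE k : D k <= E k by have := card_spanned (Y k) rI; rewrite /E /D; lia.
have DI k : D k <= #|I| by rewrite subset_leq_card // subsetIl.
have h2 : h.*2 = q.*2.+2 by rewrite /h doubleS.
have leX : \sum_(j < q.*2.+1) c (2 + j) <=
    \sum_(k < h.*2) #|(S :\: A) :&: tight_min r S k.+1|.
  rewrite h2 [leqRHS]big_ord_recr /=; apply: leq_trans (leq_addr _ _).
  apply: leq_sum => j _; apply: subset_leq_card; have sX := tight_max_min r S j.+1.
  have [[sY _] _] := tight_maxP r S j.+2; rewrite -/(Y _) in sX sY.
  by rewrite add2n; set_sub.
have leD : \sum_(k < h.*2) h.*2 * D k.+1 <=
    h * h.+1 * #|I| + \sum_(j < q.*2.+1) (2 + j.*2) * E (2 + j).
  have -> : \sum_(j < q.*2.+1) (2 + j.*2) * E (2 + j) = \sum_(k < h.*2) k.*2 * E k.+1.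
    by rewrite h2 [RHS]big_ord_recl mul0n add0n; apply: eq_bigr => j _.
  (* Of the weight [2h] of [D k.+1], the share [2h - 2k] is bounded through [#|I|] and the rest
     through [E k.+1]. *)
  apply: leq_trans (_ : \sum_(k < h.*2) (#|I| * (h.*2 - k.*2) + k.*2 * E k.+1) <= _).
    apply: leq_sum => k _; have le1 := DE k.+1; have le2 := DI k.+1.
    have := leq_mul (leqnn k.*2) le1; have := leq_mul (leqnn (h.*2 - k.*2)) le2.
    have : h.*2 * D k.+1 <= (h.*2 - k.*2) * D k.+1 + k.*2 * D k.+1.
      by rewrite -mulnDl leq_mul //; lia.
    by rewrite [#|I| * _]mulnC; lia.
  rewrite big_split leq_add2r -big_distrr /= mulnC leq_mul //.
  exact: sum_truncated_rev.
by move=> leE; apply: leq_trans leD _; rewrite leq_add2l; apply: leq_trans leE leX.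
Qed.
End Counting.
(** By the degree condition, an element of [S :\: A] lies in at most as many least minimizers of
    [r1] as it misses of [r2]. This turns the last sum of [sum_spanned_le] for [r1] into that of
    [sum_outside_tight_min] for [r2]. *)
Lemma spanned_sum_le (T : finType) (r1 r2 : rank_function T)
    (S A B I : {set T}) h :
  0 < h ->
  {in S, forall v, \sum_(k < h.*2)
     ((v \in tight_min r1 S k.+1) + (v \in tight_min r2 S k.+1)) <= h.*2} ->
  S :\: A \subset B -> r1 (A :|: I) = r1 A + #|I| ->
  h.*2 * (\sum_(k < h.*2) #|I :&: spanned r1 (tight_max r1 S k.+1)|) <=
  h * h.+1 * #|I| + h * h.+1 * r2 B.
Proof.
move=> h_gt0 memS sB rI; rewrite big_distrr /=.
apply: leq_trans (sum_spanned_le S h_gt0 rI) _; rewrite leq_add2l.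
apply: leq_trans (sum_outside_tight_min r2 S B h).
set P := S :\: A.
have sP : P \subset S :&: B by rewrite subsetI subsetDl.
apply: (@leq_trans (\sum_(k < h.*2) #|P :\: tight_min r2 S k.+1|)); last first.
  by apply: leq_sum => k _; apply/subset_leq_card/setSD.
have : \sum_(k < h.*2) #|P :&: tight_min r1 S k.+1|
     + \sum_(k < h.*2) #|P :&: tight_min r2 S k.+1| <= \sum_(k < h.*2) #|P|.
  rewrite !sum_card_setI -big_split [leqRHS]sum_nat_const card_ord.
  rewrite mulnC -sum_nat_const.
  apply: leq_sum => v /setDP[Sv _]; rewrite -big_split.
  exact: memS.
have <- : \sum_(k < h.*2) #|P :\: tight_min r2 S k.+1|
     + \sum_(k < h.*2) #|P :&: tight_min r2 S k.+1| = \sum_(k < h.*2) #|P|.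
  by rewrite -big_split; apply: eq_bigr => k _ /=; rewrite addnC cardsID.
by rewrite leq_add2r.
Qed.

(** * Alice's set and its local optimality *)

Section Sparsifier.
Variables (T : finType) (r1 r2 : rank_function T).
Implicit Types (VA S A B I : {set T}).

(* Twice the objective, with [- #|S|] replaced by [#|VA \ S|] to stay in [nat];
   the odd weight [n.*2.+1] breaks ties in favour of removing elements. *)
Definition potential n VA S :=
  (\sum_(k < n) (union_rank r1 S k.+1 + union_rank r2 S k.+1)).*2
  + n.*2.+1 * #|VA :\: S|.

Definition sparsifier n VA :=
  [arg max_(S > set0 | S \subset VA) potential n VA S].

Lemma sparsifier_sub n VA : sparsifier n VA \subset VA.
Proof. by rewrite /sparsifier; case: arg_maxnP => //; apply: sub0set. Qed.

Lemma potential_sparsifier n VA S : S \subset VA ->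
  potential n VA S <= potential n VA (sparsifier n VA).
Proof.
by rewrite /sparsifier; case: arg_maxnP => [|X _ maxX /maxX]; rewrite ?sub0set.
Qed.

(** Removing [v] gains [2n + 1] from the cardinality term, so the union ranks must drop by more than
    [n] in total; by [union_rankD1] only those of the [2n] minimizers that miss [v] allow a drop. *)
Lemma sparsifier_mem n VA v (S := sparsifier n VA) : v \in S ->
  \sum_(k < n) ((v \in tight_min r1 S k.+1) + (v \in tight_min r2 S k.+1)) < n.
Proof.
move=> Sv; have sS : S \subset VA := sparsifier_sub n VA.
have := potential_sparsifier n (subset_trans (subsetDl S [set v]) sS).
rewrite /potential -/S.
have -> : #|VA :\: (S :\ v)| = #|VA :\: S|.+1.
  rewrite (cardsD1 v) !inE eqxx /= (subsetP sS) //= add1n; congr _.+1.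
  apply: eq_card => x; rewrite !inE; case: eqP => [->|] //=; by rewrite Sv.
have : \sum_(k < n) (union_rank r1 S k.+1 + union_rank r2 S k.+1)
  + \sum_(k < n) ((v \in tight_min r1 S k.+1) + (v \in tight_min r2 S k.+1)) <=
  \sum_(k < n) (union_rank r1 (S :\ v) k.+1 + union_rank r2 (S :\ v) k.+1)
  + \sum_(k < n) 2.
  rewrite -!big_split; apply: leq_sum => k _ /=.
  have := union_rankD1 r1 k.+1 Sv; have := union_rankD1 r2 k.+1 Sv.
  by case: (v \in _); case: (v \in _) => /=; lia.
rewrite sum_nat_const card_ord mulnS.
move: (\sum_(k < n) _) (\sum_(k < n) _) (\sum_(k < n) _) => s t u.
lia.
Qed.

(** Adding [o] loses [2n + 1], so the union ranks grow by at most [n] in total, while [union_rankU1]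
    gives a growth of one for each of the [2n] maximizers that fail to span [o], a maximizer being a
    largest tight set. *)
Lemma sparsifier_notin n VA o (S := sparsifier n VA) : o \in VA :\: S ->
  n <= \sum_(k < n) ((o \in spanned r1 (tight_max r1 S k.+1))
                   + (o \in spanned r2 (tight_max r2 S k.+1))).
Proof.
case/setDP=> VAo So; have sS : S \subset VA := sparsifier_sub n VA.
have sU : o |: S \subset VA by rewrite subUset sub1set VAo.
have := potential_sparsifier n sU.
rewrite /potential -/S.
have -> : #|VA :\: S| = #|VA :\: (o |: S)|.+1.
  rewrite (cardsD1 o) !inE So VAo /= add1n; congr _.+1.
  by apply: eq_card => x; rewrite !inE negb_or andbA.
have : \sum_(k < n) (union_rank r1 S k.+1 + union_rank r2 S k.+1)
  + \sum_(k < n) 2 <=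
  \sum_(k < n) (union_rank r1 (o |: S) k.+1 + union_rank r2 (o |: S) k.+1)
  + \sum_(k < n) ((o \in spanned r1 (tight_max r1 S k.+1))
                   + (o \in spanned r2 (tight_max r2 S k.+1))).
  rewrite -!big_split; apply: leq_sum => k _ /=; rewrite !inE.
  have := union_rankU1 r1 So (ltn0Sn k); have := union_rankU1 r2 So (ltn0Sn k).
  by case: (_ == _); case: (_ == _) => /=; lia.
rewrite sum_nat_const card_ord mulnS.
move: (\sum_(k < n) _) (\sum_(k < n) _) (\sum_(k < n) _) => s t u.
lia.
Qed.

(** The least minimizers are nested, so an element of the one at level [n] would lie in all [n] of
    them, against [sparsifier_mem]. Hence the empty set is a minimizer at level [n]. *)
Lemma sparsifier_density n VA (S := sparsifier n VA) A : A \subset S ->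
  #|A| <= n * r1 A /\ #|A| <= n * r2 A.
Proof.
have tight_minn0 (r : rank_function T) :
    (forall v, v \in S -> \sum_(k < n) (v \in tight_min r S k.+1) < n) ->
    tight_min r S n = set0.
  move=> ltn; apply/eqP; rewrite -subset0; apply/subsetP => v vX.
  have [[sX _] _] := tight_minP r S n.
  have := ltn v (subsetP sX v vX); rewrite ltnNge => /negP[].
  rewrite -[X in X <= _]card_ord -sum1_card; apply: leq_sum => k _.
  by rewrite (subsetP (tight_min_anti r S (ltn_ord k))).
have dens (r : rank_function T) : tight_min r S n = set0 -> A \subset S ->
    #|A| <= n * r A.
  move=> X0 sA; have [[_ minX] _] := tight_minP r S n.
  have := minX A sA; rewrite X0 /deficit setD0 rk_set0 muln0 addn0.
  by have := cardsID A S; rewrite (setIidPr sA); lia.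
move=> sA; split; apply: dens sA; apply: tight_minn0 => v /sparsifier_mem;
  apply: leq_trans; rewrite ltnS big_split; [exact: leq_addr | exact: leq_addl].
Qed.

End Sparsifier.

Lemma spanned_sum_ge (T : finType) (r1 r2 : rank_function T) n (VA I : {set T})
    (S := sparsifier r1 r2 n VA) : I \subset VA :\: S ->
  n * #|I| <= \sum_(k < n) #|I :&: spanned r1 (tight_max r1 S k.+1)|
            + \sum_(k < n) #|I :&: spanned r2 (tight_max r2 S k.+1)|.
Proof.
move=> sI; rewrite !sum_card_setI -big_split mulnC -sum_nat_const.
by apply: leq_sum => o /(subsetP sI)/sparsifier_notin; rewrite big_split.
Qed.

(** * The rank function of a matroid given by independent sets *)

Section MatroidRank.
Variables (T : finType) (M : matroid T).
Implicit Types (X Y I J : {set T}).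

Definition matroid_rk X := \max_(I in indep M | I \subset X) #|I|.

Lemma card_le_matroid_rk X I : I \in indep M -> I \subset X -> #|I| <= matroid_rk X.
Proof. by move=> MI sI; apply: (bigop.bigmax_sup I) => //; rewrite MI. Qed.

Lemma indep_extend X I : I \in indep M -> I \subset X ->
  exists J, [/\ J \in indep M, I \subset J, J \subset X & #|J| = matroid_rk X].
Proof.
have [B [MB sB rX]] : exists B, [/\ B \in indep M, B \subset X & matroid_rk X <= #|B|].
  exists [arg max_(I > set0 | (I \in indep M) && (I \subset X)) #|I|].
  case: arg_maxnP => [|B /andP[MB sB] maxB]; first by rewrite indep0 sub0set.
  by split=> //; apply/bigop.bigmax_leqP => K /maxB.
have [n] := ubnP (#|B| - #|I|); elim: n I => // n IHn I ltn MI sI.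
have [leBI|ltIB] := leqP #|B| #|I|.
  exists I; split=> //; apply/eqP.
  by rewrite eqn_leq card_le_matroid_rk // (leq_trans rX).
have [y /setDP[By Iy] MyI] := indep_augment MI MB ltIB.
have [||J [MJ sJ sJX cJ]] := IHn (y |: I) _ MyI.
- by rewrite cardsU1 Iy; lia.
- by rewrite subUset sub1set (subsetP sB).
by exists J; split=> //; apply: subset_trans sJ; apply: subsetUr.
Qed.

Fact matroid_rk_set0 : matroid_rk set0 = 0.
Proof.
have [J [_ _ + <-]] := indep_extend (indep0 M) (sub0set set0).
by rewrite subset0 => /eqP->; rewrite cards0.
Qed.

Fact matroid_rkS X Y : X \subset Y -> matroid_rk X <= matroid_rk Y.
Proof.
move=> sXY; have [J [MJ _ sJ <-]] := indep_extend (indep0 M) (sub0set X).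
by apply: card_le_matroid_rk (subset_trans sJ sXY).
Qed.

Fact matroid_rkU1 x X : matroid_rk (x |: X) <= (matroid_rk X).+1.
Proof.
have [J [MJ _ sJ <-]] := indep_extend (indep0 M) (sub0set (x |: X)).
have : #|J :\ x| <= matroid_rk X.
  by apply: card_le_matroid_rk; [apply: indepS MJ; apply: subsetDl | rewrite subDset].
by rewrite (cardsD1 x J); case: (x \in J) => /=; lia.
Qed.

Fact matroid_rk_submod X Y :
  matroid_rk (X :|: Y) + matroid_rk (X :&: Y) <= matroid_rk X + matroid_rk Y.
Proof.
have [I [MI _ sI <-]] := indep_extend (indep0 M) (sub0set (X :&: Y)).
have sIU : I \subset X :|: Y by set_sub.
have [J [MJ sIJ sJ <-]] := indep_extend MI sIU.
have le1 : #|J :&: X| <= matroid_rk X.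
  by apply: card_le_matroid_rk; [apply: indepS MJ|]; set_sub.
have le2 : #|J :&: Y| <= matroid_rk Y.
  by apply: card_le_matroid_rk; [apply: indepS MJ|]; set_sub.
have := cardsUI (J :&: X) (J :&: Y).
have -> : J :&: X :|: J :&: Y = J by rewrite -setIUr; apply/setIidPl.
have : #|I| <= #|J :&: X :&: (J :&: Y)| by apply: subset_leq_card; set_sub.
lia.
Qed.

Definition rank_of_matroid : rank_function T :=
  RankFunction matroid_rk_set0 matroid_rkS matroid_rkU1 matroid_rk_submod.

Lemma rank_of_indep X : X \in indep M -> rank_of_matroid X = #|X|.
Proof.
move=> MX; apply/eqP; rewrite eqn_leq rk_le_card.
exact: card_le_matroid_rk.
Qed.

Lemma indep_of_rank X : rank_of_matroid X = #|X| -> X \in indep M.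
Proof.
have [J [MJ _ sJ cJ]] := indep_extend (indep0 M) (sub0set X) => rX.
by have /eqP <- : J == X by rewrite eqEcard sJ cJ -rX /=.
Qed.

End MatroidRank.

(** * Size of the message and quality of the sparsifier *)

Lemma exchange_bound q i a b m s t :
  q.+1.*2 * i <= s + t ->
  q.+1.*2 * s <= q.+1 * q.+2 * i + q.+1 * q.+2 * b ->
  q.+1.*2 * t <= q.+1 * q.+2 * i + q.+1 * q.+2 * a ->
  a + b <= m -> q.*2 * i <= q.+2 * m.
Proof.
move=> /(leq_mul (leqnn q.+1.*2)); rewrite mulnDr => le_i le_s le_t.
move=> /(leq_mul (leqnn (q.+1 * q.+2))); rewrite mulnDr => le_ab.
(* With [h = q.+1] the hypotheses add up to [4 h^2 i <= 2 h (h + 1) i + h (h + 1) m], which is [h]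
   times the goal. *)
rewrite -(@leq_pmul2l q.+1) //.
have : q.+1.*2 * (q.+1.*2 * i) = q.+1 * (q.*2 * i) + 2 * (q.+1 * q.+2 * i) by lia.
by rewrite [q.+1 * (q.+2 * m)]mulnA; lia.
Qed.

Section CommonIndep.
Variables (T : finType) (M1 M2 : matroid T).
Implicit Types (V W A S : {set T}).

Let r1 := rank_of_matroid M1.
Let r2 := rank_of_matroid M2.

Definition max_common_indep W : {set T} :=
  [arg max_(S > set0 | (S \in common_indep M1 M2) && (S \subset W)) #|S|].

Lemma max_common_indepP W (S := max_common_indep W) :
  [/\ S \in common_indep M1 M2, S \subset W & #|S| = mu M1 M2 W].
Proof.
rewrite /S /max_common_indep; case: arg_maxnP => [|X /andP[MX sX] maxX].
  by rewrite sub0set inE !indep0.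
split=> //; apply/eqP; rewrite eqn_leq (bigop.bigmax_sup X) ?MX //=.
by apply/bigop.bigmax_leqP => Y /maxX.
Qed.

Lemma mu_max W S : S \in common_indep M1 M2 -> S \subset W -> #|S| <= mu M1 M2 W.
Proof. by move=> MS sS; apply: (bigop.bigmax_sup S); rewrite ?MS. Qed.

Lemma mu_rank_cover W :
  exists2 A : {set T}, A \subset W & r1 A + r2 (W :\: A) <= mu M1 M2 W.
Proof.
have [/existsP[A /andP[sA leA]]|/existsPn nex] := boolP [exists A : {set T},
    (A \subset W) && (r1 A + r2 (W :\: A) <= mu M1 M2 W)]; first by exists A.
have [A sA|I sI [cI r1I r2I]] := @matroid_intersection T r1 r2 W (mu M1 M2 W).+1.
  by have := nex A; rewrite sA /= -ltnNge.
have := @mu_max W I _ sI; rewrite cI ltnn => H; exfalso; apply/notF/H.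
by rewrite inE !indep_of_rank // cI.
Qed.

Lemma muS V W : V \subset W -> mu M1 M2 V <= mu M1 M2 W.
Proof.
move=> sV; have [MS sS <-] := max_common_indepP V.
exact: mu_max (subset_trans sS sV).
Qed.

(** A rank cover splits [S] into two parts, each of size at most [n] times its rank in the matroid
    that covers it. *)
Lemma card_sparsifier n (VA : {set T}) :
  #|sparsifier r1 r2 n VA| <= n * mu M1 M2 VA.
Proof.
set S := sparsifier r1 r2 n VA; have sS : S \subset VA := sparsifier_sub r1 r2 n VA.
have [A sA leA] := mu_rank_cover S.
have [le1 _] := sparsifier_density (sA : A \subset S).
have [_ le2] := sparsifier_density (subsetDl S A).
rewrite -(cardsID A S) (setIidPr sA).
apply: leq_trans (leq_add le1 le2) _; rewrite -mulnDr leq_mul //.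
exact: leq_trans leA (muS sS).
Qed.

Lemma mu_sparsifier q (V VA : {set T}) (S := sparsifier r1 r2 q.+1.*2 VA) :
  VA \subset V ->
  q.*2 * mu M1 M2 V <= (q * 3 + 2) * mu M1 M2 (S :|: V :\: VA).
Proof.
move=> sVA; set W := S :|: _; set m := mu M1 M2 W.
have sS : S \subset VA := sparsifier_sub r1 r2 q.+1.*2 VA.
have [A sA leA] := mu_rank_cover W; pose B := W :\: A.
have [/setIP[M1O M2O] sO cO] := max_common_indepP V.
set O := max_common_indep V in M1O M2O sO cO.
(* Two successive bases give [#|O| <= r1 A + #|I1|] and [#|I1| <= r2 B + #|I|], whence [cI]. *)
have [I1 sI1 [rI1 eI1]] := rk_contract_basis r1 A O.
have [I sI [rI2 eI]] := rk_contract_basis r2 B I1.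
have sIO := subset_trans sI sI1.
have rI1' := rk_contract_indepS sI rI1.
have cI : mu M1 M2 V <= #|I| + m.
  have : #|O| <= r1 (A :|: O) by rewrite -(rank_of_indep M1O) rkS ?subsetUr.
  have : #|I1| <= r2 (B :|: I1).
    by rewrite -(rk_indepS sI1 (rank_of_indep M2O)) rkS ?subsetUr.
  move: leA; rewrite -/B -/m -cO; lia.
(* An element of [C] is a loop after contracting [C]; so [I] avoids both [A] and [B], hence all of
   [W]. *)
have outside (r : rank_function T) (C : {set T}) o :
    r (C :|: I) = r C + #|I| -> o \in I -> o \notin C.
  move=> rI Io; apply/negP => Co; have so : [set o] \subset I by rewrite sub1set.
  have := rk_contract_indepS so rI; rewrite cards1.
  have /setUidPl -> : [set o] \subset C by rewrite sub1set.
  by move/eqP; rewrite -[X in X == _]addn0 eqn_add2l.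
have sIV : I \subset VA :\: S.
  apply/subsetP => o Io; have := outside _ _ _ rI1' Io; have := outside _ _ _ rI2 Io.
  rewrite !inE (subsetP sO) ?(subsetP sIO) // andbT.
  by case: (o \in A); case: (o \in S); case: (o \in VA).
have memS : {in S, forall v, \sum_(k < q.+1.*2)
     ((v \in tight_min r1 S k.+1) + (v \in tight_min r2 S k.+1)) <= q.+1.*2}.
  by move=> v /sparsifier_mem/ltnW.
have memS' : {in S, forall v, \sum_(k < q.+1.*2)
     ((v \in tight_min r2 S k.+1) + (v \in tight_min r1 S k.+1)) <= q.+1.*2}.
  by move=> v /memS; under eq_bigr => k _ do rewrite addnC.
have sSA : S :\: A \subset B by apply/setSD/subsetUl.
have sSB : S :\: B \subset A.
  by apply/subsetP => z; rewrite !inE => /andP[+ Sz]; rewrite Sz /= andbT negbK.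
have := spanned_sum_le (ltn0Sn q) memS sSA rI1'.
have := spanned_sum_le (ltn0Sn q) memS' sSB rI2.
move=> le2 le1; have leI := exchange_bound (spanned_sum_ge sIV) le1 le2 leA.
apply: leq_trans (leq_mul (leqnn q.*2) cI) _.
have -> : q * 3 + 2 = q.+2 + q.*2 by clear; lia.
by rewrite mulnDr mulnDl leq_add2r.
Qed.

End CommonIndep.

(** * The protocol *)

Local Open Scope ring_scope.

Theorem theorem8 (R : realType) :
  exists2 C : R, 0 < C &
  forall eps : R, 0 < eps ->
  forall (T : finType) (M1 M2 : matroid T),
  exists (alice : {set T} -> {set T}) (bob : {set T} -> {set T} -> {set T}),
  forall V VA : {set T},
    loopless M1 V -> loopless M2 V -> VA \subset V ->
    let VB := V :\: VA in
    let msg := alice VA in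
    let out := bob VB msg in
    [/\ msg \subset VA,
        #|msg|%:R <= C * ((mu M1 M2 V)%:R / Num.min eps 1),
        out \subset msg :|: VB,
        out \in common_indep M1 M2
      & (mu M1 M2 V)%:R / (3%:R / 2%:R + eps) <= #|out|%:R :> R].
Proof.
(* The message has at most [2 (q + 1)] times [mu] elements, and [q <= 1/e + 1] with [1 <= 1/e] gives
   [2 (q + 1) <= 6/e]. *)
exists 6 => // eps eps_gt0 T M1 M2; set e := Num.min eps 1.
have e_gt0 : 0 < e by rewrite lt_min eps_gt0 ltr01.
have e_le : e <= eps by rewrite ge_min lexx.
have e_le1 : e <= 1 by rewrite ge_min lexx orbT.
(* The ratio [(3q + 2) / 2q] is [3/2 + 1/q], so [q] is chosen just large enough for [1/q <= e]. *)
have [q lt_q le_q] : exists2 q : nat, e^-1 <= q%:R & q%:R <= e^-1 + 1.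
  have /truncn_itv/andP[le_t lt_t] : 0 <= e^-1 by rewrite invr_ge0 ltW.
  by exists (Num.truncn e^-1).+1; [exact: ltW | rewrite -natr1 lerD2r].
have ie_ge1 : 1 <= e^-1 by rewrite invf_ge1.
have qe_ge1 : 1 <= q%:R * e by rewrite -ler_pdivrMr // mul1r.
exists (sparsifier (rank_of_matroid M1) (rank_of_matroid M2) q.+1.*2).
exists (fun VB msg => max_common_indep M1 M2 (msg :|: VB)).
move=> V VA _ _ sVA VB msg out.
have [Mout sout cout] := max_common_indepP M1 M2 (msg :|: VB).
have sm := card_sparsifier M1 M2 q.+1.*2 VA; have mV := muS M1 M2 sVA.
have := mu_sparsifier M1 M2 q sVA; rewrite -/msg -/VB -cout -/out => le_mu.
split=> //; first exact: sparsifier_sub.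
  have le1 : #|msg|%:R <= (q.+1.*2)%:R * (mu M1 M2 V)%:R :> R.
    by rewrite -natrM ler_nat (leq_trans sm) // leq_mul.
  apply: le_trans le1 _; rewrite mulrCA mulrC ler_wpM2l ?ler0n //.
  by rewrite -muln2 natrM -natr1; lra.
move: le_mu; rewrite -(ler_nat R) !natrM natrD natrM -muln2 natrM.
move: (mu M1 M2 V)%:R (ler0n R (mu M1 M2 V)) => m m_ge0.
move: #|out|%:R (ler0n R #|out|) => x x_ge0 le_mu.
rewrite ler_pdivrMr; last by lra.
have q_gt0 : 0 < q%:R :> R by apply: lt_le_trans lt_q; rewrite invr_gt0.
rewrite -(ler_pM2l q_gt0).
have le1 : x <= q%:R * e * x by rewrite ler_peMl.
have le2 : q%:R * e * x <= q%:R * eps * x by rewrite ler_wpM2r // ler_pM2l.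
by lra.
Qed.
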